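(* Let $n$ be a positive integer and let $$\varphi(x)=\frac{1}{n}\sum_{\pi\in\mathfrak{S}_n}\binom{x+n-1-\operatorname{cdes}(\pi)}{n-1}\,\pi$$ be the cyclic structure polynomial, a polynomial in $x$ with coefficients in the group algebra $\mathbb{Q}[\mathfrak{S}_n]$ of the symmetric group. Then, as polynomials in $x$ and $y$ with coefficients in $\mathbb{Q}[\mathfrak{S}_n]$, $$\varphi(x)\varphi(y)=\varphi(xy).$$
   Context: $\mathfrak{S}_n$ is the symmetric group, viewed as the group of bijections $\pi:[n]\to[n]$ with $[n]=\{1,2,\ldots,n\}$; the product is composition of functions, $(\sigma\tau)(s)=\sigma(\tau(s))$. A permutation $\pi\in\mathfrak{S}_n$ has a cyclic descent at position $i\in\{1,\ldots,n\}$ if $1\le i\le n-1$ and $\pi(i)>\pi(i+1)$, or if $i=n$ and $\pi(n)>\pi(1)$. The cyclic descent number $\operatorname{cdes}(\pi)$ is the number of cyclic descents of $\pi$. For a polynomial $p$ and an integer $m\ge 0$, $\binom{p}{m}=\frac{p(p-1)\cdots(p-m+1)}{m!}$. The variables $x,y$ are commuting indeterminates that also commute with the elements of the group algebra. *)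

(* Defs.v *)
From HB Require Import structures.
From mathcomp Require Import all_boot all_order all_algebra all_fingroup.

Set Implicit Arguments.
Unset Strict Implicit.
Unset Printing Implicit Defensive.

Import GRing.Theory.
Local Open Scope ring_scope.

(* Composition of functions. MathComp's own product of permutations composes
   in the opposite order: (s * t)%g i = t (s i). *)
Definition perm_comp n (s t : 'S_n) : 'S_n := (t * s)%g.

Lemma perm_compE n (s t : 'S_n) i : perm_comp s t i = s (t i).
Proof. exact: permM. Qed.

Lemma perm_compA n : associative (@perm_comp n).
Proof. by move=> s t u; rewrite /perm_comp mulgA. Qed.

(* The group algebra Q[S_n]: the rational vector space of the functions
   S_n -> Q. The product extends perm_comp bilinearly; it is not the pointwise
   product that MathComp provides on finite functions. *)
Definition symalg (n : nat) : Type := {ffun 'S_n -> rat^o}.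

HB.instance Definition _ n := GRing.Lmodule.on (symalg n).

Section SymAlg.
Variable n : nat.
Implicit Types (s t u : 'S_n) (f g h : symalg n).

Definition sbasis s : symalg n := [ffun t => (t == s)%:R].

Definition symalg_one : symalg n := sbasis 1%g.

Definition symalg_mul f g : symalg n :=
  \sum_s \sum_t ((f s : rat) * g t) *: sbasis (perm_comp s t).

Lemma symalg_expand f : f = \sum_s (f s : rat) *: sbasis s.
Proof.
apply/ffunP=> t; rewrite sum_ffunE (bigD1 t) //= big1 ?addr0.
  by rewrite !ffunE eqxx /GRing.scale /= mulr1.
by move=> s st; rewrite !ffunE eq_sym (negPf st) scaler0.
Qed.

Let symalg_mulDl : left_distributive symalg_mul +%R.
Proof.
move=> f g h; rewrite /symalg_mul -big_split; apply: eq_bigr => s _ /=.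
rewrite -big_split; apply: eq_bigr => t _ /=.
by rewrite -scalerDl ffunE mulrDl.
Qed.

Let symalg_mulDr : right_distributive symalg_mul +%R.
Proof.
move=> f g h; rewrite /symalg_mul -big_split; apply: eq_bigr => s _ /=.
rewrite -big_split; apply: eq_bigr => t _ /=.
by rewrite -scalerDl ffunE mulrDr.
Qed.

Let symalg_mulZl (a : rat) f g : a *: symalg_mul f g = symalg_mul (a *: f) g.
Proof.
rewrite /symalg_mul scaler_sumr; apply: eq_bigr => s _.
rewrite scaler_sumr; apply: eq_bigr => t _.
by rewrite scalerA ffunE mulrA.
Qed.

Let symalg_mulZr (a : rat) f g : a *: symalg_mul f g = symalg_mul f (a *: g).
Proof.
rewrite /symalg_mul scaler_sumr; apply: eq_bigr => s _.
rewrite scaler_sumr; apply: eq_bigr => t _.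
by rewrite scalerA ffunE mulrCA.
Qed.

Let symalg_mul0l g : symalg_mul 0 g = 0.
Proof. by have := symalg_mulZl 0 0 g; rewrite !scale0r. Qed.

Let symalg_mul0r f : symalg_mul f 0 = 0.
Proof. by have := symalg_mulZr 0 f 0; rewrite !scale0r. Qed.

Let symalg_mul_suml (I : finType) (F : I -> symalg n) g :
  symalg_mul (\sum_i F i) g = \sum_i symalg_mul (F i) g.
Proof. exact: (big_morph (symalg_mul^~ g) (fun f h => symalg_mulDl f h g) (symalg_mul0l g)). Qed.

Let symalg_mul_sumr (I : finType) f (G : I -> symalg n) :
  symalg_mul f (\sum_i G i) = \sum_i symalg_mul f (G i).
Proof. exact: (big_morph (symalg_mul f) (symalg_mulDr f) (symalg_mul0r f)). Qed.

Lemma symalg_mul_basis s t :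
  symalg_mul (sbasis s) (sbasis t) = sbasis (perm_comp s t).
Proof.
rewrite /symalg_mul (bigD1 s) //= [X in _ + X]big1 => [|u us].
  rewrite (bigD1 t) //= [X in _ + X + _]big1 => [|u ut].
    by rewrite !ffunE !eqxx mulr1 scale1r !addr0.
  by rewrite [X in _ * X]ffunE (negPf ut) mulr0 scale0r.
by apply: big1 => v _; rewrite [X in X * _]ffunE (negPf us) mul0r scale0r.
Qed.

Let symalg_mulA : associative symalg_mul.
Proof.
have mulAs s g h : symalg_mul (sbasis s) (symalg_mul g h) =
                   symalg_mul (symalg_mul (sbasis s) g) h.
  have mulAst t : symalg_mul (sbasis s) (symalg_mul (sbasis t) h) =
                  symalg_mul (symalg_mul (sbasis s) (sbasis t)) h.
    rewrite (symalg_expand h) [symalg_mul (sbasis t) _]symalg_mul_sumr.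
    rewrite !symalg_mul_sumr; apply: eq_bigr => u _.
    by rewrite -!symalg_mulZr !symalg_mul_basis perm_compA.
  rewrite (symalg_expand g) [symalg_mul _ h]symalg_mul_suml.
  rewrite [symalg_mul _ (\sum_i _ *: sbasis i)]symalg_mul_sumr.
  rewrite symalg_mul_suml [LHS]symalg_mul_sumr; apply: eq_bigr => t _.
  by rewrite -symalg_mulZl -!symalg_mulZr -symalg_mulZl mulAst.
move=> f g h; rewrite (symalg_expand f) [LHS]symalg_mul_suml.
rewrite [symalg_mul _ g]symalg_mul_suml [RHS]symalg_mul_suml.
by apply: eq_bigr => s _; rewrite -!symalg_mulZl mulAs.
Qed.

Let symalg_mul1l : left_id symalg_one symalg_mul.
Proof.
move=> f; rewrite [in RHS](symalg_expand f) {1}(symalg_expand f) symalg_mul_sumr.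
apply: eq_bigr => s _.
by rewrite -symalg_mulZr symalg_mul_basis /perm_comp mulg1.
Qed.

Let symalg_mul1r : right_id symalg_one symalg_mul.
Proof.
move=> f; rewrite [in RHS](symalg_expand f) {1}(symalg_expand f) symalg_mul_suml.
apply: eq_bigr => s _.
by rewrite -symalg_mulZl symalg_mul_basis /perm_comp mul1g.
Qed.

Let symalg_one_neq0 : symalg_one != 0.
Proof.
apply/eqP => /ffunP/(_ 1%g); rewrite !ffunE eqxx => /eqP.
by rewrite oner_eq0.
Qed.

HB.instance Definition _ := GRing.Zmodule_isNzRing.Build (symalg n)
  symalg_mulA symalg_mul1l symalg_mul1r symalg_mulDl symalg_mulDr symalg_one_neq0.

HB.instance Definition _ :=
  GRing.Lmodule_isLalgebra.Build rat (symalg n) symalg_mulZl.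

HB.instance Definition _ :=
  GRing.Lalgebra_isAlgebra.Build rat (symalg n) symalg_mulZr.

Lemma sbasisM s t : sbasis s * sbasis t = sbasis (perm_comp s t).
Proof. exact: symalg_mul_basis. Qed.

End SymAlg.

(* Positions and values are shifted to 0 .. n-1; ordS sends the last position
   n-1 to 0. *)
Definition cdes n (pi : 'S_n) : nat :=
  #|[set i : 'I_n | (pi (ordS i) < pi i)%N]|.

Definition pbinom (p : {poly rat}) (m : nat) : {poly rat} :=
  (m`!%:R)^-1 *: \prod_(i < m) (p - i%:R).

Definition cyclic_structure_poly n : {poly symalg n} :=
  (n%:R^-1 : rat)%:A *:
    \sum_(pi : 'S_n)
      map_poly (in_alg (symalg n))
        (pbinom ('X + n%:R - 1 - (cdes pi)%:R) n.-1) * (sbasis pi)%:P.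

(* Polynomials in two commuting variables x and y that also commute with the
   coefficients, as iterated univariate polynomials. *)
Definition poly2 (A : nzRingType) : nzRingType := {poly {poly A}}.
Definition varx (A : nzRingType) : poly2 A := 'X%:P.
Definition vary (A : nzRingType) : poly2 A := 'X.

Definition subst2 (A : nzRingType) (p : {poly A}) (q : poly2 A) : poly2 A :=
  (map_poly (polyC \o polyC) p).[q].

(* Main.v *)
Require Import Defs.
From HB Require Import structures.
From mathcomp Require Import all_boot all_order all_algebra all_fingroup.
From mathcomp Require Import zify.

(** Let n = m + 1. By polynomiality it suffices to multiply the elements
    Phi_k = \sum_pi 'C(k + n - 1 - cdes pi, n - 1) pi for integers k > 0.
    Since the sum over x of (pi (x + 1) - pi x mod n) is n * cdes pi, the number
    cdes pi does not change when pi is composed with a rotation of Z/n, on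
    either side. Let R be the sum of the n rotations; then R Phi_k = n Phi_k.
    Every permutation is uniquely the composition, in that order, of one that
    fixes the last point with a rotation, so Phi_k = W_k R where W_k is the part
    of Phi_k supported on the permutations that fix the last point. As for
    P-partitions, W_k is the sum of the inverse standardizations of the words in
    [k]^n whose last letter is maximal, and merging a pair of words into a word
    of pairs gives W_j W_k = W_{jk}. Hence Phi_j Phi_k = W_j R Phi_k
    = n W_j W_k R = n Phi_{jk}. *)

Set Implicit Arguments.
Unset Strict Implicit.
Unset Printing Implicit Defensive.

Import GRing.Theory Num.Theory.

(** * Standardization *)

Section Standardization.
Variable n : nat.
Implicit Types (e : 'I_n -> nat) (s : 'S_n).

Definition rank e (x : 'I_n) : nat := #|[set y | e y < e x]|.

Lemma rank_ltn e x : rank e x < n.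
Proof.
rewrite -[X in _ < X]card_ord -cardsT; apply: proper_card.
by apply/properP; split; [apply/subsetP | exists x; rewrite ?inE ?ltnn].
Qed.

Lemma ltn_rank e x y : (rank e x < rank e y) = (e x < e y).
Proof.
have le_rank u v : e u <= e v -> rank e u <= rank e v.
  move=> uv; apply: subset_leq_card; apply/subsetP => z; rewrite !inE => zu.
  exact: leq_trans zu uv.
apply/idP/idP; first by apply: contraLR; rewrite -!leqNgt; apply: le_rank.
move=> xy; apply: proper_card; apply/properP; split.
  by apply/subsetP => z; rewrite !inE => /ltn_trans; apply.
by exists x; rewrite inE ?ltnn.
Qed.

Definition rank_ord e x : 'I_n := Ordinal (rank_ltn e x).

Lemma rank_ord_inj e : injective e -> injective (rank_ord e).
Proof.
move=> eI x y [] rxy; apply: eI.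
by case: (ltngtP (e x) (e y)) => //; rewrite -ltn_rank rxy ltnn.
Qed.

Definition std e (eI : injective e) : 'S_n := perm (rank_ord_inj eI).

Lemma stdE e (eI : injective e) x : std eI x = rank e x :> nat.
Proof. by rewrite permE. Qed.

Lemma ltn_std e (eI : injective e) x y : (std eI x < std eI y) = (e x < e y).
Proof. by rewrite !stdE ltn_rank. Qed.

Lemma card_ord_ltn (i : 'I_n) : #|[set l : 'I_n | l < i]| = i.
Proof.
pose w := widen_ord (ltnW (ltn_ord i)).
have wI : injective w by move=> a b /(congr1 val) /= ab; apply: val_inj.
rewrite -[RHS]card_ord -[RHS](card_imset predT wI).
apply: eq_card => l; rewrite inE; apply/idP/imsetP => [li|[l' _ ->]].
  by exists (Ordinal li) => //; apply: val_inj.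
exact: (ltn_ord l').
Qed.

(** Here [s] lists the points by increasing [e], so the points preceding [s i] are the [s l] with
    [l < i], and the rank of [s i] is [i]. *)
Lemma std_eqVP e (eI : injective e) s :
  std eI = (s^-1)%g <-> (forall i i' : 'I_n, i < i' -> e (s i) < e (s i')).
Proof.
split=> [es i i' ii'|mono].
  by rewrite -(ltn_std eI) es !permK.
have monoE i i' : (e (s i) < e (s i')) = (i < i').
  apply/idP/idP; last exact: mono.
  apply: contraLR; rewrite -!leqNgt leq_eqVlt => /predU1P[/val_inj->//|].
  by move/mono/ltnW.
apply/permP => x; apply: val_inj; rewrite /= stdE -{1}(permKV s x).
set i := (s^-1)%g x; rewrite -[RHS]card_ord_ltn /rank.
rewrite -[RHS](card_imset _ (@perm_inj _ s)).
apply: eq_card => y; rewrite inE; apply/idP/imsetP => [|[l + ->]].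
  rewrite -{1}(permKV s y) monoE => yi.
  by exists ((s^-1)%g y); rewrite ?inE ?permKV.
by rewrite inE monoE.
Qed.

End Standardization.

Lemma ltn_lex n (a a' : nat) (s s' : 'I_n) :
  (a * n + s < a' * n + s') = (a < a') || (a == a') && (s < s').
Proof.
have sn := ltn_ord s; have sn' := ltn_ord s'.
case: (ltngtP a a') => [lt_a|lt_a|->] /=; last by rewrite ltn_add2l.
  have : a.+1 * n <= a' * n by rewrite leq_mul2r lt_a orbT.
  by rewrite mulSn; lia.
have : a'.+1 * n <= a * n by rewrite leq_mul2r lt_a orbT.
by rewrite mulSn; lia.
Qed.

Lemma ord_ltn_homo m (f : 'I_m.+1 -> nat) :
  (forall l : 'I_m, f (inord l) < f (inord l.+1)) ->
  forall i i' : 'I_m.+1, i < i' -> f i < f i'.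
Proof.
move=> fS; suff H d i : i + d < m -> f (inord i) < f (inord (i + d).+1).
  move=> i i' ii'; have := H (i' - i).-1 i; have im := ltn_ord i'.
  have -> : i + (i' - i).-1 = i'.-1 by lia.
  by rewrite prednK ?inord_val; [apply; lia | lia].
elim: d => [|d IH] im; first by rewrite addn0 in im *; apply: (fS (Ordinal im)).
rewrite addnS in im *; apply: ltn_trans (IH (ltnW im)) _.
exact: (fS (Ordinal im)).
Qed.

(** * Counting words with prescribed strict steps *)

Section GappedWords.
Variables (D : nat -> bool).
Let A i := \sum_(l < i) ~~ D l.

Let AS i : A i.+1 = A i + ~~ D i.
Proof. by rewrite /A big_ord_recr. Qed.

Let A_le i : A i <= i.
Proof. by elim: i => [|i IH]; [rewrite /A big_ord0 | rewrite AS; lia]. Qed.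

(* Adding to each letter the number of weak steps on its left turns these words
   into strictly increasing ones. *)
Lemma card_gapped_words m k :
  #|[set a : {ffun 'I_m.+1 -> 'I_k.+1} | (a ord_max == k :> nat) &&
      [forall i : 'I_m, a (inord i) + D i <= a (inord i.+1)]]|
  = 'C(k + \sum_(i < m) ~~ D i, m).
Proof.
rewrite -/(A m) -card_ltn_sorted_tuples; set N := k + A m.
(* The last letter is forced, so [t] holds only the other [m] shifted letters; the default value [N]
   supplies the shifted last one. *)
pose e (t : m.-tuple 'I_N) i := nth N (map val t) i.
have eE (t : m.-tuple 'I_N) (i : 'I_m) : e t i = tnth t i.
  by rewrite /e (tnth_nth (tnth t i)) (nth_map (tnth t i)) ?size_tuple.
have em (t : m.-tuple 'I_N) : e t m = N.
  by rewrite /e nth_default // size_map size_tuple.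
have eN (t : m.-tuple 'I_N) i : i < m -> e t i < N.
  by move=> im; rewrite (eE t (Ordinal im)).
have eS (t : m.-tuple 'I_N) : sorted ltn (map val t) ->
    forall i, i < m -> e t i < e t i.+1.
  move=> st i im; case: (ltnP i.+1 m) => [i1m|mi]; last first.
    have -> : i.+1 = m by lia.
    by rewrite em eN.
  by apply: (sorted_ltn_nth ltn_trans); rewrite ?inE ?size_map ?size_tuple.
have e_ge (t : m.-tuple 'I_N) : sorted ltn (map val t) ->
    forall i, i <= m -> i <= e t i.
  move=> st; elim=> [|i IH] im //.
  by have := eS t st i im; have := IH (ltnW im); lia.
(* Going down from position [m], [e t] drops by at least one per step and [A] by at most one, so
   [e t i - A i] never exceeds [k]. *)
have e_le (t : m.-tuple 'I_N) : sorted ltn (map val t) ->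
    forall d i, i + d = m -> e t i <= k + A i.
  move=> st; elim=> [|d IH] i im.
    by rewrite addn0 in im; rewrite im em.
  have im' : i < m by lia.
  have := eS t st i im'; have := IH i.+1; rewrite AS.
  by move=> /(_ ltac:(lia)); case: (D i) => /=; lia.
pose g (t : m.-tuple 'I_N) : {ffun 'I_m.+1 -> 'I_k.+1} :=
  [ffun i : 'I_m.+1 => inord (e t i - A i)].
have gE (t : m.-tuple 'I_N) (i : nat) : sorted ltn (map val t) -> i <= m ->
    g t (inord i) + A i = e t i.
  move=> st im; have iE : (inord i : 'I_m.+1) = i :> nat by rewrite inordK.
  rewrite ffunE iE inordK.
    by apply: subnK; apply: leq_trans (A_le i) (e_ge _ st _ im).
  by have := e_le t st (m - i) i (subnKC im); lia.
have ordmE : ord_max = inord m :> 'I_m.+1 by apply: val_inj; rewrite /= inordK.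
rewrite -[RHS](@card_in_imset _ _ g); last first.
  move=> t t'; rewrite !inE => st st' gtt'; apply: eq_from_tnth => i.
  by apply: val_inj; rewrite /= -!eE -!gE ?gtt' // ltnW.
apply: eq_card => a; rewrite inE; apply/andP/imsetP => [[am /forallP aS]|[t]].
  have bS i : i < m -> a (inord i) + A i < a (inord i.+1) + A i.+1.
    move=> im; have := aS (Ordinal im); rewrite /= AS.
    by case: (D i) => /=; lia.
  have bN (i : 'I_m) : a (inord i) + A i < N.
    have b_mono (l l' : 'I_m.+1) : l < l' -> a l + A l < a l' + A l'.
      apply: (@ord_ltn_homo m (fun l => a l + A l)) => {l l'} l.
      have lm := ltn_ord l; have lm' := ltnW lm.
      by rewrite !inordK //; apply: bS.
    have im := ltn_ord i; have im' := ltnW im.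
    by have := b_mono (inord i) ord_max; rewrite (eqP am) inordK //; apply.
  pose t := [tuple Ordinal (bN i) | i < m].
  have et i : i <= m -> e t i = a (inord i) + A i.
    rewrite leq_eqVlt => /predU1P[->|im]; first by rewrite em -ordmE (eqP am).
    by rewrite (eE _ (Ordinal im)) tnth_mktuple.
  exists t.
    rewrite inE; apply/(sortedP N) => i; rewrite size_map size_tuple => im.
    by have := bS i (ltnW im); rewrite -!et // 1?ltnW // ltnW.
  apply/ffunP => i; apply: val_inj; have im : i <= m by rewrite -ltnS.
  by rewrite ffunE et // addnK !inord_val.
rewrite inE => st ->; split.
  by have := gE t m st (leqnn m); rewrite em -ordmE => /addIn->.
apply/forallP => i; have im := ltn_ord i.
have := eS t st i im; have := gE t i st (ltnW im); have := gE t i.+1 st im.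
rewrite AS.
by case: (D i) => /=; lia.
Qed.

End GappedWords.

(** * Cyclic descents and rotations *)

Lemma cdes_le n (s : 'S_n) : cdes s <= n.
Proof. by rewrite -[X in _ <= X]card_ord; apply: max_card. Qed.

Section CyclicDescents.
Variable m : nat.
Implicit Types (s : 'S_m.+1) (i x : 'I_m.+1).

(** Subtraction in Z/(m+1) wraps around exactly when [b < a], so each cyclic descent will contribute
    one extra [m.+1]. *)
Lemma val_Zp_sub (a b : 'I_m.+1) :
  val (b - a)%R + a = b + m.+1 * (b < a).
Proof.
have am := ltn_ord a; have bm := ltn_ord b.
rewrite /= modnDmr; case: ltnP => ba /=.
  by rewrite modn_small; lia.
have -> : b + (m.+1 - a) = (b - a) + m.+1 by lia.
by rewrite modnDr modn_small; lia.
Qed.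

(* Makes the invariance of [cdes] under rotation of positions and of values
   obvious. *)
Lemma cdes_sum s : m.+1 * cdes s = \sum_x val (s (ordS x) - s x)%R.
Proof.
(* Both [s x] and [s (ordS x)] run once over all values, so their sums cancel. *)
apply/(@addIn (\sum_x val (s x))).
rewrite -[RHS]big_split /=.
rewrite (eq_bigr _ (fun x _ => val_Zp_sub (s x) (s (ordS x)))).
rewrite big_split /= -big_distrr /= addnC; congr (_ + _ * _); last first.
  rewrite /cdes -sum1dep_card [LHS]big_mkcond.
  by apply: eq_bigr => x _; case: ltnP.
have sum_val (f : 'I_m.+1 -> 'I_m.+1) :
    injective f -> \sum_x val (f x) = \sum_(x < m.+1) x.
  by move=> fI; rewrite [RHS](reindex f) //; apply: onW_bij; apply: injF_bij.
by rewrite !sum_val //; [move=> x y /perm_inj /ordS_inj | apply: perm_inj].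
Qed.

Definition rotation i : 'S_m.+1 := perm (addIr i).

Lemma rotationE i x : rotation i x = (x + i)%R.
Proof. exact: permE. Qed.

Lemma ordS_rotation i x : ordS (rotation i x) = rotation i (ordS x).
Proof.
have ordSE y : ordS y = (y + inZp 1)%R.
  by apply: val_inj; rewrite /= modnDmr addn1.
by rewrite !rotationE !ordSE addrAC.
Qed.

Lemma cdes_rotation_pos i s : cdes (rotation i * s)%g = cdes s.
Proof.
apply/eqP; rewrite -(@eqn_pmul2l m.+1) // !cdes_sum; apply/eqP.
rewrite [RHS](reindex (rotation i)); last first.
  by apply: onW_bij; apply: injF_bij; apply: perm_inj.
by apply: eq_bigr => x _; rewrite !permM ordS_rotation.
Qed.

Lemma cdes_rotation_val i s : cdes (s * rotation i)%g = cdes s.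
Proof.
apply/eqP; rewrite -(@eqn_pmul2l m.+1) // !cdes_sum; apply/eqP.
by apply: eq_bigr => x _; rewrite !permM !rotationE opprD addrACA subrr addr0.
Qed.

(** The successor counts the last position, whose maximal value is followed cyclically by a smaller
    one; for [m = 0] there is no such descent. *)
Lemma cdes_fix_max s : 0 < m -> s ord_max = ord_max ->
  cdes s = (\sum_(l < m) (s (inord l.+1) < s (inord l))).+1.
Proof.
move=> m_gt0 smax; rewrite /cdes -sum1dep_card big_mkcond big_ord_recr /=.
rewrite smax ifT ?addn1; last first.
  rewrite ltn_neqAle leq_ord andbT -[X in _ != X](congr1 val smax).
  rewrite (inj_eq val_inj) (inj_eq perm_inj) -(inj_eq val_inj) /= modnn.
  by lia.
congr _.+1; apply: eq_bigr => l _.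
have -> : widen_ord (leqnSn m) l = inord l.
  by apply: val_inj; rewrite /= inordK // ltnS ltnW.
have -> : ordS (inord l) = inord l.+1 :> 'I_m.+1.
  have lm := ltn_ord l; apply: val_inj.
  by rewrite /= modn_small !inordK //; lia.
by case: ltnP.
Qed.

End CyclicDescents.

(** * Words *)

Section Words.
Variables (m k : nat).
Implicit Types (s : 'S_m.+1) (w : {ffun 'I_m.+1 -> 'I_k.+1}).

(* Encodes the lexicographic order on the pairs (w x, x). *)
Definition key w (x : 'I_m.+1) : nat := w x * m.+1 + x.

Lemma key_inj w : injective (key w).
Proof.
move=> x y /(congr1 (modn^~ m.+1)); rewrite /key !modnMDl !modn_small //.
exact: val_inj.
Qed.

Definition word_std w : 'S_m.+1 := std (@key_inj w).

(** The last point has the largest letter and the largest index, hence the largest key. *)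
Lemma word_std_max w : w ord_max = ord_max -> word_std w ord_max = ord_max.
Proof.
move=> wmax; apply/eqP; apply: contraT => neq.
have : word_std w ord_max < word_std w ((word_std w)^-1 ord_max)%g.
  by rewrite permKV ltn_neqAle leq_ord andbT.
rewrite ltn_std /key ltn_lex wmax /= !ltnNge !leq_ord /=.
by rewrite andbF.
Qed.

Definition permute_word s w : {ffun 'I_m.+1 -> 'I_k.+1} := [ffun x => w (s x)].

Lemma permute_word_bij s : bijective (permute_word s).
Proof.
exists (permute_word s^-1) => w;
by apply/ffunP => x; rewrite !ffunE ?permK ?permKV.
Qed.

(** The keys must increase when [w] is read in the order [s]: the letters increase weakly, and
    strictly at each descent of [s], where the index cannot break a tie. The permuted words are
    therefore gapped words. *)
Lemma card_words s : s ord_max = ord_max ->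
  #|[set w : {ffun 'I_m.+1 -> 'I_k.+1} |
     (w ord_max == ord_max) && ((word_std w)^-1 == s)%g]|
  = 'C(k + m.+1 - cdes s, m).
Proof.
move=> smax; pose D l : bool := s (inord l.+1) < s (inord l).
have -> : 'C(k + m.+1 - cdes s, m) = 'C(k + \sum_(l < m) ~~ D l, m).
  (* For [m = 0] the upper entries differ, but both binomials are 1. *)
  have bin_m0 a : m = 0 -> 'C(a, m) = 1 by move->; rewrite bin0.
  case: (posnP m) => [m0|m_gt0]; first by rewrite !bin_m0.
  congr 'C(_, m); rewrite cdes_fix_max //.
  have : \sum_(l < m) ~~ D l + \sum_(l < m) D l = m.
    rewrite -big_split /= -[RHS]card_ord -sum1_card.
    by apply: eq_bigr => l _; case: (D l).
  rewrite -[X in _ - X.+1]/(\sum_(l < m) D l).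
  by move: (\sum_(l < m) ~~ D l) (\sum_(l < m) D l) => a b; lia.
rewrite -card_gapped_words.
rewrite -[RHS](on_card_preimset (onW_bij _ (permute_word_bij s))).
apply: eq_card => w; rewrite !inE ffunE smax -(inj_eq val_inj) /=.
congr (_ && _).
have gap (l : 'I_m) : (key w (s (inord l)) < key w (s (inord l.+1))) =
    (permute_word s w (inord l) + D l <= permute_word s w (inord l.+1)).
  rewrite /key ltn_lex !ffunE /D.
  have : s (inord l) != s (inord l.+1) :> nat.
    rewrite (inj_eq val_inj) (inj_eq perm_inj) -(inj_eq val_inj) /=.
    by have lm := ltn_ord l; rewrite !inordK ?ltnS //; lia.
  move: (nat_of_ord (s _)) (nat_of_ord (s _)) => p q pq.
  by case: (ltngtP p q) pq => // _ _; case: ltngtP => //=; lia.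
rewrite -(inj_eq invg_inj) invgK; apply/eqP/forallP => [/std_eqVP ms l|ms].
  have lm := ltn_ord l; rewrite -gap.
  by apply: ms; rewrite !inordK //; lia.
apply/std_eqVP; apply: (@ord_ltn_homo _ (fun i => key w (s i))) => l.
by rewrite gap.
Qed.

End Words.

(** * Merging pairs of words *)

Section MergedWords.
Variables m j k : nat.
Let jk := (j.+1 * k.+1).-1.
Implicit Types (u : {ffun 'I_m.+1 -> 'I_j.+1}) (v : {ffun 'I_m.+1 -> 'I_k.+1}).

(* The letter (v x, u x), in the lexicographic order of the pairs. *)
Definition merge_words
    (p : {ffun 'I_m.+1 -> 'I_j.+1} * {ffun 'I_m.+1 -> 'I_k.+1}) :
    {ffun 'I_m.+1 -> 'I_jk.+1} :=
  [ffun x => inord (p.2 x * j.+1 + p.1 x)].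

Lemma merge_wordsE u v x : merge_words (u, v) x = v x * j.+1 + u x :> nat.
Proof.
rewrite ffunE inordK //=.
have := ltn_ord (u x); have := ltn_ord (v x); rewrite /jk prednK; nia.
Qed.

Lemma merge_words_bij : bijective merge_words.
Proof.
exists (fun w : {ffun 'I_m.+1 -> 'I_jk.+1} =>
  ([ffun x => inord (w x %% j.+1)] : {ffun 'I_m.+1 -> 'I_j.+1},
   [ffun x => inord (w x %/ j.+1)] : {ffun 'I_m.+1 -> 'I_k.+1})).
  move=> [u v]; congr (_, _); apply/ffunP => x; rewrite ffunE merge_wordsE.
    by rewrite modnMDl modn_small ?inord_val.
  by rewrite divnMDl // divn_small // addn0 inord_val.
move=> w; apply/ffunP => x; apply: val_inj.
apply: etrans (merge_wordsE _ _ _) _; rewrite !ffunE !inordK.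
- by rewrite -divn_eq.
- by rewrite ltn_mod.
- by rewrite ltn_divLR // mulnC -[X in _ < X]prednK // muln_gt0.
Qed.

Lemma merge_words_max u v x :
  (merge_words (u, v) x == ord_max) = (u x == ord_max) && (v x == ord_max).
Proof.
rewrite -!(inj_eq val_inj) /= merge_wordsE /jk.
have ux := ltn_ord (u x); have vx := ltn_ord (v x).
by apply/eqP/andP => [E|[/eqP-> /eqP->]]; [split; apply/eqP; nia | nia].
Qed.

(** The merged key compares first the letters of [v] at [word_std u x], then [u x], then [x]. The
    last two comparisons amount to comparing [word_std u x], so this is the order of the keys of [v]
    at [word_std u x]. *)
Lemma word_std_merge u v :
  word_std (merge_words (u, permute_word (word_std u) v)) =
  (word_std u * word_std v)%g.
Proof.
apply/permP => x; apply: val_inj; rewrite permM /= !stdE /rank.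
rewrite -[LHS](card_imset _ (@perm_inj _ (word_std u))).
set w := merge_words _.
have keyE y : (key w y < key w x) =
              (key v (word_std u y) < key v (word_std u x)).
  rewrite /key !ltn_lex ltn_std /key ltn_lex !merge_wordsE !ffunE.
  have uy := ltn_ord (u y); have ux := ltn_ord (u x).
  rewrite (@ltn_lex j.+1 _ _ (u y) (u x)).
  case: (ltngtP (v (word_std u y)) (v (word_std u x))) => vyx /=.
  - by [].
  - case: eqP => //= E; nia.
  - by rewrite vyx eqn_add2l.
apply: eq_card => y; rewrite inE; apply/imsetP/idP => [[z + ->]|yx].
  by rewrite inE keyE.
by exists ((word_std u)^-1 y)%g; rewrite ?inE ?keyE permKV.
Qed.

End MergedWords.

Local Open Scope ring_scope.

(** * Products in the group algebra *)

Section IntegerParameters.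
Variable m : nat.
Implicit Types (s : 'S_m.+1).

(* In [word_sum], [cyc_coeff] and [cyc_sum] the integer parameter is k.+1. *)
Definition word_sum k : symalg m.+1 :=
  \sum_(w : {ffun 'I_m.+1 -> 'I_k.+1} | w ord_max == ord_max)
    sbasis (word_std w)^-1%g.

Lemma word_sumM j k :
  word_sum j * word_sum k = word_sum (j.+1 * k.+1).-1.
Proof.
transitivity (\sum_(u : {ffun 'I_m.+1 -> 'I_j.+1} | u ord_max == ord_max)
  \sum_(v : {ffun 'I_m.+1 -> 'I_k.+1} | v ord_max == ord_max)
    sbasis (word_std (merge_words (u, v)))^-1%g); last first.
  rewrite pair_big /= [RHS](reindex (@merge_words m j k)); last first.
    exact/onW_bij/merge_words_bij.
  by apply: eq_big => [[u v]|[u v] _] //; rewrite merge_words_max.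
rewrite /word_sum mulr_suml; apply: eq_bigr => u /eqP umax.
(* For fixed [u] this permutes the words [v], and keeps the last letter because [word_std u] fixes
   the last point. Inversion and [perm_comp] each reverse the product, so the orders agree. *)
rewrite [RHS](reindex (permute_word (word_std u))) /=; last first.
  exact/onW_bij/permute_word_bij.
rewrite mulr_sumr; apply: eq_big => v; first by rewrite ffunE word_std_max.
by rewrite word_std_merge invMg sbasisM.
Qed.

Definition cyc_coeff k s : rat := 'C(k + m.+1 - cdes s, m)%:R.

Lemma word_sumE k :
  word_sum k =
  \sum_(s : 'S_m.+1 | s ord_max == ord_max) cyc_coeff k s *: sbasis s.
Proof.
rewrite /word_sum (partition_big (fun w => (word_std w)^-1%g)
  (fun s : 'S_m.+1 => s ord_max == ord_max)) /=; last first.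
  by move=> w /eqP wmax; rewrite -{1}(word_std_max wmax) permK.
apply: eq_bigr => s /eqP smax; rewrite /cyc_coeff -card_words // -sum1dep_card.
rewrite natr_sum scaler_suml; apply: eq_bigr => w /andP[_ /eqP->].
by rewrite scale1r.
Qed.

Definition cyc_sum k : symalg m.+1 := \sum_s cyc_coeff k s *: sbasis s.

Definition rot_sum : symalg m.+1 := \sum_i sbasis (@rotation m i).

Lemma word_sum_rot k : word_sum k * rot_sum = cyc_sum k.
Proof.
transitivity (\sum_(i < m.+1)
    \sum_(s : 'S_m.+1 | s ((rotation i)^-1%g ord_max) == ord_max)
      cyc_coeff k s *: sbasis s).
  rewrite mulr_sumr; apply: eq_bigr => i _; rewrite word_sumE mulr_suml.
  rewrite [RHS](reindex (fun s => rotation i * s)%g) /=; last first.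
    by apply: onW_bij; apply: injF_bij; apply: mulgI.
  apply: eq_big => s; first by rewrite permM permKV.
  by rewrite -scalerAl sbasisM /cyc_coeff cdes_rotation_pos.
rewrite (exchange_big_dep xpredT) //=; apply: eq_bigr => s _.
(* The rotation in the factorization of [s] must carry the preimage of the last point under [s] to
   the last point. *)
rewrite (big_pred1 (ord_max - (s^-1)%g ord_max)) // => i.
rewrite -(inj_eq (@perm_inj _ (s^-1)%g)) permK.
rewrite -(inj_eq (@perm_inj _ (rotation i))) permKV rotationE.
by rewrite [RHS]eq_sym subr_eq addrC.
Qed.

Lemma rot_cyc_sum k : rot_sum * cyc_sum k = m.+1%:R *: cyc_sum k.
Proof.
rewrite mulr_suml (eq_bigr (fun _ => cyc_sum k)) => [|i _].
  by rewrite sumr_const card_ord scaler_nat.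
rewrite [RHS](reindex (fun s => s * rotation i)%g) /=; last first.
  by apply: onW_bij; apply: injF_bij; apply: mulIg.
rewrite mulr_sumr; apply: eq_bigr => s _.
by rewrite -scalerAr sbasisM /cyc_coeff cdes_rotation_val.
Qed.

Lemma cyc_sumM j k :
  cyc_sum j * cyc_sum k = m.+1%:R *: cyc_sum (j.+1 * k.+1).-1.
Proof.
rewrite -(word_sum_rot j) -mulrA rot_cyc_sum -scalerAr -(word_sum_rot k).
by rewrite mulrA word_sumM word_sum_rot.
Qed.

Lemma symalg_sumE n (c : 'S_n -> rat) t :
  (\sum_s c s *: sbasis s : symalg n) t = c t.
Proof.
rewrite sum_ffunE (bigD1 t) //= big1 ?addr0 => [|s st].
  by rewrite !ffunE eqxx /GRing.scale /= mulr1.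
by rewrite !ffunE eq_sym (negPf st) scaler0.
Qed.

(** This is [cyc_sumM] read at the coefficient of [t], a rational identity that can be extended to
    polynomials. *)
Lemma cyc_coeffM j k (t : 'S_m.+1) :
  \sum_(p : 'S_m.+1 * 'S_m.+1 | perm_comp p.1 p.2 == t)
    cyc_coeff j p.1 * cyc_coeff k p.2
  = m.+1%:R * cyc_coeff (j.+1 * k.+1).-1 t.
Proof.
have := cyc_sumM j k; rewrite /cyc_sum.
have -> : (\sum_s cyc_coeff j s *: sbasis s) *
          (\sum_s cyc_coeff k s *: sbasis s) =
    \sum_t (\sum_(p : 'S_m.+1 * 'S_m.+1 | perm_comp p.1 p.2 == t)
      cyc_coeff j p.1 * cyc_coeff k p.2) *: sbasis t :> symalg m.+1.
  rewrite mulr_suml; transitivity (\sum_(p : 'S_m.+1 * 'S_m.+1)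
      (cyc_coeff j p.1 * cyc_coeff k p.2) *: sbasis (perm_comp p.1 p.2)).
    rewrite -(pair_bigA _ (fun s s' =>
      (cyc_coeff j s * cyc_coeff k s') *: sbasis (perm_comp s s'))) /=.
    apply: eq_bigr => s _; rewrite mulr_sumr; apply: eq_bigr => s' _.
    by rewrite -scalerAl -scalerAr scalerA sbasisM.
  rewrite (partition_big (fun p => perm_comp p.1 p.2) xpredT) //=.
  apply: eq_bigr => u _; rewrite scaler_suml.
  by apply: eq_bigr => p /eqP->.
rewrite scaler_sumr [X in _ = X -> _](eq_bigr (fun s =>
  (m.+1%:R * cyc_coeff (j.+1 * k.+1).-1 s) *: sbasis s)).
  by move/(congr1 (fun f : symalg m.+1 => f t)); rewrite !symalg_sumE.
by move=> s _; rewrite scalerA.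
Qed.

End IntegerParameters.

(** * From integers to polynomials *)

Lemma prod_subr_ffact (R : nzRingType) (N m : nat) :
  \prod_(i < m) (N%:R - i%:R) = (N ^_ m)%:R :> R.
Proof.
elim: m => [|m IH]; first by rewrite big_ord0 ffactn0.
rewrite big_ord_recr /= IH ffactnSr natrM.
case: (leqP m N) => [mN|Nm]; first by rewrite natrB.
by rewrite ffact_small ?mul0r.
Qed.

Definition perm_poly n (s : 'S_n) : {poly rat} :=
  n%:R^-1 *: pbinom ('X + n%:R - 1 - (cdes s)%:R) n.-1.

Lemma perm_polyE m (s : 'S_m.+1) k :
  (perm_poly s).[k.+1%:R] = m.+1%:R^-1 * cyc_coeff k s.
Proof.
rewrite hornerZ; congr (_ * _); rewrite /pbinom hornerZ horner_prod.
rewrite (eq_bigr (fun i : 'I_m => (k + m.+1 - cdes s)%N%:R - i%:R)) => [|i _].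
  rewrite prod_subr_ffact -bin_ffact natrM mulrC mulfK //.
  by rewrite pnatr_eq0 -lt0n fact_gt0.
rewrite !hornerE -!polyC_natr !hornerE; congr (_ - _).
(* Truncated subtraction is exact here because [cdes s] is at most [m.+1]. *)
rewrite natrB; last by apply: leq_trans (cdes_le s) (leq_addl _ _).
by congr (_ - _); rewrite natrD -[k.+1]addn1 natrD addrAC addrK.
Qed.

(** Over a domain, infinitely many roots force a polynomial to vanish; this is used in the outer
    variable, then in the inner one. *)
Lemma poly2_eq0 (R : numDomainType) (p : {poly {poly R}}) :
  (forall j k : nat, p.[j.+1%:R%:P].[k.+1%:R] = 0) -> p = 0.
Proof.
have natP (S : idomainType) (f : nat -> S) (q : {poly S}) :
    injective f -> (forall k, q.[f k] = 0) -> q = 0.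
  move=> fI q0; apply/eqP; apply: contraT => qn0.
  have := max_poly_roots (rs := [seq f k | k <- iota 0 (size q)]) qn0.
  rewrite size_map size_iota ltnn map_inj_uniq ?iota_uniq //; apply=> //.
  by apply/allP => _ /mapP[k _ ->]; rewrite /root q0.
have natI : injective (fun k => k.+1%:R : R).
  by move=> a b /eqP; rewrite eqr_nat => /eqP[].
move=> p0; apply: (natP _ (fun k => k.+1%:R%:P)) => [a b /polyC_inj/natI//|j].
exact: (natP _ _ _ natI).
Qed.

Lemma horner_subst2 (p : {poly rat}) (q : {poly {poly rat}}) (a b : rat) :
  (subst2 p q).[a%:P].[b] = p.[q.[a%:P].[b]].
Proof.
pose ev := horner_eval b \o horner_eval a%:P.
apply: etrans (esym (horner_map ev _ _)) _.
rewrite -map_poly_comp map_poly_id //.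
by move=> c _; rewrite /= /horner_eval !hornerC.
Qed.

Lemma subst2_perm_polyM m (t : 'S_m.+1) :
  \sum_(p : 'S_m.+1 * 'S_m.+1 | perm_comp p.1 p.2 == t)
    subst2 (perm_poly p.1) (varx _) * subst2 (perm_poly p.2) (vary _)
  = subst2 (perm_poly t) (varx _ * vary _).
Proof.
apply/eqP; rewrite -subr_eq0; apply/eqP/poly2_eq0 => j k.
(* As [varx] is the inner variable, it takes the second value, which swaps the roles of [j] and [k]
   in [cyc_coeffM]. *)
have xE : (varx rat).[j.+1%:R%:P].[k.+1%:R] = k.+1%:R.
  by rewrite hornerC hornerX.
have yE : (vary rat).[j.+1%:R%:P].[k.+1%:R] = j.+1%:R.
  by rewrite hornerX hornerC.
have xyE : (varx rat * vary rat).[j.+1%:R%:P].[k.+1%:R] =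
           (k.+1 * j.+1).-1.+1%:R.
  by rewrite !hornerM xE yE -natrM.
rewrite !hornerD !hornerN !horner_sum horner_subst2 xyE.
rewrite perm_polyE; apply/eqP; rewrite subr_eq0; apply/eqP.
transitivity (\sum_(p : 'S_m.+1 * 'S_m.+1 | perm_comp p.1 p.2 == t)
   m.+1%:R^-1 * m.+1%:R^-1 * (cyc_coeff k p.1 * cyc_coeff j p.2) : rat).
  apply: eq_bigr => p _.
  by rewrite !hornerM !horner_subst2 xE yE !perm_polyE mulrACA.
by rewrite -mulr_sumr cyc_coeffM -mulrA mulKf // pnatr_eq0.
Qed.

Definition lift2 n : {poly {poly rat}} -> poly2 (symalg n) :=
  map_poly (map_poly (in_alg (symalg n))).
HB.instance Definition _ n := GRing.RMorphism.on (lift2 n).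

(* Evaluation in [poly2 (symalg n)] is multiplicative only at points, such as
   these, that commute with the coefficients. *)
Lemma lift2_comm n q (c : symalg n) : GRing.comm (lift2 n q) c%:P%:P.
Proof.
apply/polyP => i; rewrite coefMC coefCM; apply/polyP => l.
by rewrite coefMC coefCM /lift2 coef_map coef_map /= mulr_algl mulr_algr.
Qed.

(** Separating the basis elements leaves the substitution to rational polynomials, where evaluation
    is multiplicative. *)
Lemma subst2_lift n q :
  subst2 (cyclic_structure_poly n) (lift2 n q) =
  \sum_(s : 'S_n) lift2 n (subst2 (perm_poly s) q) * (sbasis s)%:P%:P.
Proof.
have -> : cyclic_structure_poly n =
    \sum_s map_poly (in_alg (symalg n)) (perm_poly s) * (sbasis s)%:P.
  rewrite /cyclic_structure_poly scaler_sumr; apply: eq_bigr => s _.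
  by rewrite scalerAl /perm_poly [in RHS]map_polyZ.
rewrite /subst2 rmorph_sum horner_sum; apply: eq_bigr => s _.
rewrite rmorphM /= map_polyC hornerM_comm; last first.
  rewrite /comm_poly hornerC; exact: lift2_comm.
rewrite hornerC; congr (_ * _); rewrite -(horner_map (lift2 n)).
rewrite -!map_poly_comp; congr (_.[_]); apply: eq_map_poly => c.
by rewrite /= /lift2 map_polyC /= map_polyC.
Qed.

Theorem theorem1p2 (n : nat) (n_gt0 : (0 < n)%N) :
  let phi := subst2 (cyclic_structure_poly n) in
  let x := varx (symalg n) in
  let y := vary (symalg n) in
  phi x * phi y = phi (x * y).
Proof.
case: n n_gt0 => // m _ phi x y.
have xE : x = lift2 m.+1 (varx _).
  by rewrite /lift2 /x /varx map_polyC /= map_polyX.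
have yE : y = lift2 m.+1 (vary _) by rewrite /lift2 /y /vary map_polyX.
rewrite xE yE -rmorphM /phi !subst2_lift mulr_suml.
pose F (s s' : 'S_m.+1) :=
  lift2 m.+1 (subst2 (perm_poly s) (varx _) * subst2 (perm_poly s') (vary _)) *
  (sbasis (perm_comp s s'))%:P%:P.
transitivity (\sum_(p : 'S_m.+1 * 'S_m.+1) F p.1 p.2).
  rewrite -(pair_bigA _ F) /=.
  apply: eq_bigr => s _; rewrite mulr_sumr; apply: eq_bigr => s' _.
  rewrite /F rmorphM -sbasisM !polyCM !mulrA; congr (_ * _).
  (* The basis element of [s] moves past the rational polynomial attached to [s']. *)
  by rewrite -!mulrA; congr (_ * _); rewrite lift2_comm.
rewrite (partition_big (fun p => perm_comp p.1 p.2) xpredT) //=.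
apply: eq_bigr => u _; rewrite -subst2_perm_polyM rmorph_sum mulr_suml.
by apply: eq_bigr => p /eqP <-.
Qed.
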